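(* Let $M_2=\begin{pmatrix}a&b\\c&d\end{pmatrix}$, and let $\mathcal L$ be the set of skew lines in $\mathbb P^3_K$ corresponding to $\{M_0,M_\infty,M_1,M_2\}$. Then $G_{\mathcal L}\cong C_3$ (the cyclic group of order $3$) if and only if $\operatorname{tr}(M_2)=\det(M_2)=1$.
   Context: $K$ is an algebraically closed field and $\mathbb P^3=\mathbb P(K^2\oplus K^2)$. The line corresponding to a matrix $M\in\mathrm{GL}_2(K)$ is $\{(v,Mv)\mid v\in K^2\}$; $M_1=I$; the line corresponding to $M_0=0$ is $L_0=\{(v,0)\}$, and the line corresponding to the symbol $M_\infty$ is $L_\infty=\{(0,v)\}$. Two lines are skew if they are disjoint; the lines of $\mathcal L$ are pairwise skew. For three distinct pairwise skew lines $L_i,L_j,L_k$, the map $f_{ijk}:L_i\to L_j$ sends $p\in L_i$ to the unique intersection point of $L_j$ with the plane spanned by $p$ and $L_k$. For a finite set $\mathcal L$ of at least three pairwise skew lines, $C_{\mathcal L}$ is the groupoid whose objects are the lines of $\mathcal L$ and whose arrows are the maps $f_{ijk}$ (with $L_i,L_j,L_k\in\mathcal L$ distinct) together with all their possible compositions; the groups $\mathrm{Hom}_{C_{\mathcal L}}(L_i,L_i)\subseteq\mathrm{Aut}(L_i)\cong\mathrm{PGL}_2(K)$ are all isomorphic, and $G_{\mathcal L}$ denotes this common group.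
   Formalization: The case where K has characteristic 3 and M_2 = -I is excluded: there tr(M_2) = det(M_2) = 1 and the four lines are distinct and pairwise skew, but G_L is trivial, so the claim as stated fails. *)

(* Defs.v *)
From HB Require Import structures.
From mathcomp Require Import all_boot all_order all_algebra all_fingroup.

Set Implicit Arguments.
Unset Strict Implicit.
Unset Printing Implicit Defensive.

Import GRing.Theory.
Local Open Scope ring_scope.

(* P^3 = P(K^2 (+) K^2): its points, lines and planes are the subspaces of
   K^2 (+) K^2 of dimension 1, 2 and 3. *)
Definition space4 (K : fieldType) : vectType K := ('cV[K]_2 * 'cV[K]_2)%type.

Record line (K : fieldType) :=
  Line { line_space :> {vspace space4 K}; _ : \dim line_space == 2%N }.
HB.instance Definition _ (K : fieldType) := [isSub for @line_space K].
HB.instance Definition _ (K : fieldType) := [Equality of line K by <:].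

Record point_on (K : fieldType) (L : line K) :=
  PointOn { point_space :> {vspace space4 K};
            _ : (\dim point_space == 1%N) && (point_space <= L)%VS }.
HB.instance Definition _ (K : fieldType) (L : line K) := [isSub for @point_space K L].
HB.instance Definition _ (K : fieldType) (L : line K) := [Equality of point_on L by <:].

Definition skew (K : fieldType) (L L' : line K) : bool := (L :&: L' == 0)%VS.

Lemma dim_space4 (K : fieldType) : \dim {: space4 K} = 4%N.
Proof. by rewrite dimvf. Qed.

Lemma proj_subproof (K : fieldType) (Li Lj Lk : line K) (p : point_on Li) :
  skew Li Lk -> skew Lj Lk ->
  (\dim ((p + Lk) :&: Lj)%VS == 1%N) && ((p + Lk) :&: Lj <= Lj)%VS.
Proof.
case: Li Lj Lk p => [Li di] [Lj dj] [Lk dk] [p /= /andP[dp spi]].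
rewrite /skew /= => ik jk; rewrite capvSr andbT.
have pk : (p :&: Lk = 0)%VS.
  by apply/eqP; rewrite -subv0 -(eqP ik) capvS.
have d3 : \dim (p + Lk) = 3%N.
  by have := dimv_sum_cap p Lk; rewrite pk dimv0 addn0 (eqP dp) (eqP dk).
have d4 : \dim (p + Lk + Lj) = 4%N.
  have d : \dim (Lj + Lk) = 4%N.
    by have := dimv_sum_cap Lj Lk; rewrite (eqP jk) dimv0 addn0 (eqP dj) (eqP dk).
  apply/eqP; rewrite eqn_leq; apply/andP; split.
    by rewrite -(dim_space4 K) dimvS ?subvf.
  by rewrite -d; apply: dimvS; rewrite subv_add addvSr (subv_trans (addvSr p Lk)) ?addvSl.
by have := dimv_sum_cap (p + Lk) Lj; rewrite d3 d4 (eqP dj) => /eqP.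
Qed.

(* f_ijk : L_i -> L_j, p |-> <p, L_k> /\ L_j. *)
Definition proj_map (K : fieldType) (Li Lj Lk : line K)
    (ik : skew Li Lk) (jk : skew Lj Lk) (p : point_on Li) : point_on Lj :=
  PointOn (proj_subproof p ik jk).

Definition pairwise_skew (K : fieldType) (Ls : seq (line K)) : Prop :=
  {in Ls &, forall L L', L != L' -> skew L L'}.

(* Hom_{C_Ls}(L, L').  Arrows are maps, so they are taken up to pointwise
   equality ([arrow_ext]). *)
Inductive arrow (K : fieldType) (Ls : seq (line K)) :
    forall L L' : line K, (point_on L -> point_on L') -> Prop :=
| arrow_proj Li Lj Lk (ik : skew Li Lk) (jk : skew Lj Lk) of
    Li \in Ls & Lj \in Ls & Lk \in Ls & uniq [:: Li; Lj; Lk] :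
    arrow Ls (proj_map ik jk)
| arrow_id L of L \in Ls : arrow Ls (@id (point_on L))
| arrow_comp L L' L'' (f : point_on L -> point_on L')
    (g : point_on L' -> point_on L'') of
    arrow Ls f & arrow Ls g : arrow Ls (g \o f)
| arrow_ext L L' (f g : point_on L -> point_on L') of
    f =1 g & arrow Ls f : arrow Ls g.

(* Hom_{C_Ls}(L, L), under composition, is isomorphic to gT. *)
Definition vertex_group_isog (K : fieldType) (Ls : seq (line K)) (L : line K)
    (gT : finGroupType) : Prop :=
  exists phi : gT -> point_on L -> point_on L,
    [/\ forall x y : gT, phi (x * y)%g =1 phi x \o phi y,
        forall x y : gT, phi x =1 phi y -> x = y
      & forall f : point_on L -> point_on L,
          arrow Ls f <-> exists x : gT, f =1 phi x].

Definition graph_fun (K : fieldType) (M : 'M[K]_2) (v : 'cV[K]_2) : space4 K :=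
  (v, M *m v).

Definition vert_fun (K : fieldType) (w : 'cV[K]_2) : space4 K := (0, w).

Lemma graph_fun_is_linear (K : fieldType) (M : 'M[K]_2) : linear (graph_fun M).
Proof.
move=> a u v; rewrite /graph_fun mulmxDr -scalemxAr.
by congr (_, _).
Qed.

HB.instance Definition _ (K : fieldType) (M : 'M[K]_2) :=
  GRing.isLinear.Build K _ _ _ (@graph_fun K M) (@graph_fun_is_linear K M).

Lemma vert_fun_is_linear (K : fieldType) : linear (@vert_fun K).
Proof. by move=> a u v; congr (_, _); rewrite /= scaler0 addr0. Qed.

HB.instance Definition _ (K : fieldType) :=
  GRing.isLinear.Build K _ _ _ (@vert_fun K) (@vert_fun_is_linear K).

Lemma dim_limg_inj (K : fieldType) (f : {linear 'cV[K]_2 -> space4 K}) :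
  injective f -> \dim (limg (linfun f)) == 2%N.
Proof.
move=> f_inj; rewrite limg_dim_eq ?dimvf //.
have -> : lker (linfun f) = 0%VS by apply/eqP/lker0P => u v; rewrite !lfunE => /f_inj.
by rewrite capv0.
Qed.

Lemma graph_fun_inj (K : fieldType) (M : 'M[K]_2) : injective (graph_fun M).
Proof. by move=> u v []. Qed.

Lemma vert_fun_inj (K : fieldType) : injective (@vert_fun K).
Proof. by move=> u v []. Qed.

Definition line_of (K : fieldType) (M : 'M[K]_2) : line K :=
  Line (dim_limg_inj (@graph_fun_inj K M)).

Definition line_infty (K : fieldType) : line K :=
  Line (dim_limg_inj (@vert_fun_inj K)).

Lemma mem_line_of (K : fieldType) (M : 'M[K]_2) (x : space4 K) :
  (x \in line_space (line_of M)) = (x.2 == M *m x.1).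
Proof.
apply/memv_imgP/eqP => [[v _ ->]|e]; first by rewrite lfunE.
by exists x.1; rewrite ?memvf // lfunE /= /graph_fun -e; case: x {e}.
Qed.

Lemma mem_line_infty (K : fieldType) (x : space4 K) :
  (x \in line_space (line_infty K)) = (x.1 == 0).
Proof.
apply/memv_imgP/eqP => [[v _ ->]|e]; first by rewrite lfunE.
by exists x.2; rewrite ?memvf // lfunE /= /vert_fun -e; case: x {e}.
Qed.

(* Main.v *)
Require Import Defs.
From mathcomp Require Import all_boot all_order all_algebra all_fingroup.
From mathcomp Require Import ring.
Import GRing.Theory.
Local Open Scope ring_scope.

(** Give each line a frame (s, T), so that it is {(s v, T v) | v in K^2}: the
four lines have frames (1, 0), (0, 1), (1, 1) and (1, A) with A = M2.  Put
D_ij = s_i T_j - s_j T_i.  If (s_i, T_i) v = (s_j, T_j) u + (s_k, T_k) x, then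
eliminating x gives D_ik v = D_jk u, so f_ijk acts as D_jk^-1 D_ik.  Up to sign
the D_ij are 1, A and A - 1, hence the vertex groups are the image of
<A, A - 1> in PGL_2.  If this has order 3, then A is not scalar, A^3 is scalar
and A - 1 is proportional to A^2.  By Cayley-Hamilton, with t = tr A and
d = det A, the former gives t^2 = d and the latter t = d, whence t = d = 1;
this argument is uniform in the characteristic.  Conversely t = d = 1 gives
A - 1 = A^2 and A^3 = -1, and A generates a group of order 3 as soon as it is
not scalar. *)

(** * Frames of lines and the matrices of maps between lines *)

Section Frames.

Set Implicit Arguments.
Unset Strict Implicit.

Variable K : fieldType.
Implicit Types (L : line K) (F : K * 'M[K]_2) (B : 'M[K]_2) (v : 'cV[K]_2).

Definition frame_fun F v : space4 K := (F.1 *: v, F.2 *m v).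

Lemma frame_funZ F c v : frame_fun F (c *: v) = c *: frame_fun F v.
Proof. by congr (_, _); rewrite /= ?scalemxAr // !scalerA mulrC. Qed.

Lemma frame_fun0 F : frame_fun F 0 = 0.
Proof. by congr (_, _); rewrite /= (scaler0, mulmx0). Qed.

Definition is_frame L F : Prop :=
  injective (frame_fun F) /\
  forall x, x \in line_space L <-> exists v, x = frame_fun F v.

Lemma frame_fun_eq0 L F v : is_frame L F -> (frame_fun F v == 0) = (v == 0).
Proof. by case=> injF _; rewrite -(inj_eq injF) frame_fun0. Qed.

Lemma frame_line_mem L F v : is_frame L F -> frame_fun F v \in line_space L.
Proof. by case=> _ memL; apply/memL; exists v. Qed.

Lemma point_vector L F (p : point_on L) :
  is_frame L F -> exists2 v, v != 0 & point_space p = <[frame_fun F v]>%VS.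
Proof.
case: p => p pP frF /=; case/andP: (pP) => /eqP dimp sub_pL.
have px : vpick p \in p by apply: memv_pick.
have nz : vpick p != 0 by rewrite vpick0 -dimv_eq0 dimp.
have [v def_v] : exists v, vpick p = frame_fun F v.
  by case: (frF) => _ memL; apply/memL/(subvP sub_pL).
exists v; first by rewrite -(frame_fun_eq0 v frF) -def_v.
apply/esym/eqP; rewrite -def_v eqEdim dimp dim_vline nz andbT.
by rewrite -memvE.
Qed.

Lemma vector_point L F v : is_frame L F -> v != 0 ->
  exists p : point_on L, point_space p = <[frame_fun F v]>%VS.
Proof.
move=> frF nz_v.
suff pP : (\dim <[frame_fun F v]>%VS == 1%N) && (<[frame_fun F v]> <= L)%VS.
  by exists (PointOn pP).
by rewrite dim_vline (frame_fun_eq0 v frF) nz_v -memvE frame_line_mem.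
Qed.

(** Matrix of a map in the homogeneous coordinates of the two frames, hence meaningful only up to a
    nonzero scalar; [v] is kept nonzero because only such vectors span points. *)
Definition acts_by L L' F F' (f : point_on L -> point_on L') B : Prop :=
  forall (p : point_on L) v, v != 0 -> point_space p = <[frame_fun F v]>%VS ->
  point_space (f p) = <[frame_fun F' (B *m v)]>%VS.

Lemma unitmx_mul_neq0 B v : B \in unitmx -> v != 0 -> B *m v != 0.
Proof. by move=> uB; apply: contraNneq => Bv0; rewrite -(mulKmx uB v) Bv0 mulmx0. Qed.

Lemma vline_scale (c : K) (x : space4 K) : c != 0 -> (<[c *: x]> = <[x]>)%VS.
Proof.
move=> nz_c; apply/eqP; rewrite eqEsubv -!memvE memvZ ?memv_line //=.
by apply/vlineP; exists c^-1; rewrite scalerK.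
Qed.

Lemma acts_by_scale L L' F F' (f : point_on L -> point_on L') B c :
  c != 0 -> acts_by F F' f B -> acts_by F F' f (c *: B).
Proof.
move=> nz_c fB p v nz_v pE.
by rewrite (fB p v) // -scalemxAl frame_funZ vline_scale.
Qed.

Lemma acts_by_id L F : acts_by F F (@id (point_on L)) 1%:M.
Proof. by move=> p v _ ->; rewrite mul1mx. Qed.

Lemma acts_by_comp L L' L'' F F' F'' (f : point_on L -> point_on L')
    (g : point_on L' -> point_on L'') B B' :
  B \in unitmx -> acts_by F F' f B -> acts_by F' F'' g B' ->
  acts_by F F'' (g \o f) (B' *m B).
Proof.
move=> uB fB gB' p v nz_v pE; rewrite -mulmxA; apply: gB'.
  exact: unitmx_mul_neq0.
exact: fB.
Qed.

Lemma acts_by_ext L L' F F' (f g : point_on L -> point_on L') B :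
  f =1 g -> acts_by F F' f B -> acts_by F F' g B.
Proof. by move=> fg fB p v nz_v pE; rewrite -fg; apply: fB. Qed.

Lemma acts_by_eq L L' F F' (f g : point_on L -> point_on L') B :
  is_frame L F -> acts_by F F' f B -> acts_by F F' g B -> f =1 g.
Proof.
move=> frF fB gB p; have [v nz_v pE] := point_vector p frF.
by apply: val_inj; rewrite /= (fB p v) // (gB p v).
Qed.

(** Each basis vector shares the eigenvalue of the sum [e 0 + e 1], so the two eigenvalues agree. *)
Lemma scalar_mx_of_eigen B : (forall v, exists c, B *m v = c *: v) ->
  exists c, B = c%:M.
Proof.
move=> eigB.
pose e (i : 'I_2) : 'cV[K]_2 := delta_mx i 0.
have Be i j c : B *m e i = c *: e i -> B j i = c * (j == i)%:R.
  by move=> /matrixP/(_ j 0); rewrite -colE !mxE eqxx andbT.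
have [a Ba] := eigB (e 0); have [b Bb] := eigB (e 1).
have [c Bc] := eigB (e 0 + e 1).
move: Bc; rewrite mulmxDr Ba Bb scalerDr => Bc.
have ac : a = c.
  by have /matrixP/(_ 0 0) := Bc; rewrite !mxE /= !(mulr1, mulr0, addr0).
have bc : b = c.
  by have /matrixP/(_ 1 0) := Bc; rewrite !mxE /= !(mulr1, mulr0, add0r).
exists c; apply/matrixP => i j; rewrite mxE -mulr_natr.
have [->|->] : j = 0 \/ j = 1.
- by case: j => [[|[|j]] ?] //; [left|right]; apply: val_inj.
- by rewrite -ac; apply: Be.
- by rewrite -bc; apply: Be.
Qed.

Lemma unitmx_of_inj B : (forall u : 'cV_2, B *m u = 0 -> u = 0) -> B \in unitmx.
Proof.
move=> injB; rewrite -unitmx_tr unitmxE unitfE.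
apply/det0P => -[w nz_w wB0]; case/eqP: nz_w; apply: trmx_inj.
by rewrite trmx0; apply: injB; rewrite -[B]trmxK -trmx_mul wB0 trmx0.
Qed.

(** A nonzero kernel vector would send a point to the zero subspace. *)
Lemma acts_by_unitmx L L' F F' (f : point_on L -> point_on L') B :
  is_frame L F -> is_frame L' F' -> acts_by F F' f B -> B \in unitmx.
Proof.
move=> frF frF' fB; apply: unitmx_of_inj => u Bu; apply/eqP/contraT => nz_u.
have [p pE] := vector_point frF nz_u.
case: (f p) (fB p u nz_u pE) => q /= /andP[dim_q _] qE.
by move: dim_q; rewrite qE Bu frame_fun0 dim_vline eqxx.
Qed.

(** The quotient [invmx B *m B'] fixes every point, so every vector is an eigenvector and the
    quotient is scalar. This is the passage from GL_2 to PGL_2. *)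
Lemma acts_by_uniq L L' F F' (f : point_on L -> point_on L') B B' :
  is_frame L F -> is_frame L' F' ->
  acts_by F F' f B -> acts_by F F' f B' -> exists2 c, c != 0 & B' = c *: B.
Proof.
move=> frF frF' fB fB'.
have uB := acts_by_unitmx frF frF' fB; have uB' := acts_by_unitmx frF frF' fB'.
have [c defc] : exists c, invmx B *m B' = c%:M.
  apply: scalar_mx_of_eigen => v.
  have [-> | nz_v] := eqVneq v 0; first by exists 0; rewrite mulmx0 scaler0.
  have [p pE] := vector_point frF nz_v.
  have : frame_fun F' (B' *m v) \in <[frame_fun F' (B *m v)]>%VS.
    by rewrite -(fB p v) // (fB' p v) // memv_line.
  case/vlineP => c; rewrite -frame_funZ => /(proj1 frF') eqBv.
  by exists c; rewrite -mulmxA eqBv -scalemxAr mulKmx.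
have defB' : B' = c *: B by rewrite -(mulKVmx uB B') defc mul_mx_scalar.
exists c => //; apply: contraTneq uB' => c0.
by rewrite defB' c0 scale0r unitmxE det0 unitr0.
Qed.

(** Blockwise determinant of the 4 by 4 matrix with the scalar blocks [F.1], [F'.1] above the blocks
    [F.2], [F'.2]. *)
Definition frame_det F F' : 'M[K]_2 := F.1 *: F'.2 - F'.1 *: F.2.

(** For [u] in the kernel, [F'.1 *: u] and [F.1 *: u] are the coordinates of one vector common to
    both lines, so skewness makes both zero. If both first entries vanish, the two lines are
    vertical and [u] again yields a common vector. *)
Lemma skew_frame_det_unit L L' F F' :
  is_frame L F -> is_frame L' F' -> Defs.skew L L' -> frame_det F F' \in unitmx.
Proof.
move=> frF frF' LL'.
have disjoint u w : frame_fun F u = frame_fun F' w -> u = 0 /\ w = 0.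
  move=> uw; have : frame_fun F u \in (L :&: L')%VS.
    by rewrite memv_cap frame_line_mem //= uw frame_line_mem.
  rewrite (eqP LL') memv0 => u0; split; apply/eqP.
    by rewrite -(frame_fun_eq0 _ frF).
  by rewrite -(frame_fun_eq0 _ frF') -uw.
apply: unitmx_of_inj => u /eqP; rewrite mulmxBl -!scalemxAl subr_eq0 => /eqP Du.
have [s's] : F'.1 *: u = 0 /\ F.1 *: u = 0.
  apply: disjoint; congr (_, _); first by rewrite !scalerA mulrC.
  by rewrite /= -!scalemxAr Du.
have [s0 | nz_s] := eqVneq F.1 0; last first.
  by move/eqP; rewrite scaler_eq0 (negPf nz_s) => /eqP.
have [s'0 _ | nz_s' _] := eqVneq F'.1 0; last first.
  by move/eqP: s's; rewrite scaler_eq0 (negPf nz_s') => /eqP.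
have uF : F.2 \in unitmx.
  apply: unitmx_of_inj => w Fw; apply: (proj1 frF).
  by rewrite frame_fun0 /frame_fun s0 scale0r Fw.
suff [] : invmx F.2 *m (F'.2 *m u) = 0 /\ u = 0 by [].
by apply: disjoint; rewrite /frame_fun s0 s'0 !scale0r mulKVmx.
Qed.

Lemma acts_by_proj_map Li Lj Lk Fi Fj Fk (ik : Defs.skew Li Lk) (jk : Defs.skew Lj Lk) :
  is_frame Li Fi -> is_frame Lj Fj -> is_frame Lk Fk ->
  acts_by Fi Fj (proj_map ik jk) (invmx (frame_det Fj Fk) *m frame_det Fi Fk).
Proof.
move=> fri frj frk p v nz_v pE.
have uik := skew_frame_det_unit fri frk ik.
have ujk := skew_frame_det_unit frj frk jk.
have fullv_jk : (Lj + Lk = fullv)%VS.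
  apply/eqP; rewrite eqEdim subvf dim_space4.
  have := dimv_sum_cap Lj Lk; rewrite (eqP jk) dimv0 addn0 => ->.
  by case: (Lj) (Lk) => [? /= /eqP->] [? /= /eqP->].
(* Since [Lj] and [Lk] are complementary, the vector splits along them; its component in [Lj] lies
   in the plane through [p] and [Lk], so it spans the image point. *)
have /memv_addP[y /(proj2 frj)[u ->] [z /(proj2 frk)[x ->] def_v]] :
  frame_fun Fi v \in (Lj + Lk)%VS by rewrite fullv_jk memvf.
(* Eliminate [x] between the two coordinates of [def_v]. *)
have Dv : frame_det Fi Fk *m v = frame_det Fj Fk *m u.
  case: def_v => e1 e2; rewrite !mulmxBl -!scalemxAl e2.
  rewrite scalemxAr e1 mulmxDr -!scalemxAr scalerDr.
  by rewrite opprD addrACA subrr addr0.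
have Bv : (invmx (frame_det Fj Fk) *m frame_det Fi Fk) *m v = u.
  by rewrite -mulmxA Dv mulKmx.
have nz_u : u != 0.
  by rewrite -Bv unitmx_mul_neq0 // unitmx_mul unitmx_inv ujk uik.
have /andP[/eqP dim1 _] := proj_subproof p ik jk.
apply/esym/eqP; rewrite eqEdim /= dim1 dim_vline Bv (frame_fun_eq0 u frj) nz_u andbT.
rewrite -memvE memv_cap frame_line_mem // andbT.
apply/memv_addP; exists (frame_fun Fi v); first by rewrite pE memv_line.
exists (- frame_fun Fk x); first by rewrite memvN frame_line_mem.
by rewrite def_v addrK.
Qed.

End Frames.

(** * The four lines and the matrices of their arrows *)

Section FourLines.

Set Implicit Arguments.
Unset Strict Implicit.

Variables (K : fieldType) (A : 'M[K]_2).
Implicit Types L : line K.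

Definition four_lines : seq (line K) :=
  [:: line_of 0; line_infty K; line_of 1%:M; line_of A].

(** The last frame doubles as the default value, so the list of four frames exhausts the values on
    all lines. *)
Definition frame_of L : K * 'M[K]_2 :=
  if L == line_infty K then (0, 1%:M) else
  if L == line_of 0 then (1, 0) else
  if L == line_of 1%:M then (1, 1%:M) else (1, A).

Lemma is_frame_line_of (M : 'M[K]_2) : is_frame (line_of M) (1, M).
Proof.
split=> [u v [] | x]; first by rewrite !scale1r.
rewrite mem_line_of; split=> [/eqP x2 | [v ->]] /=; last by rewrite scale1r.
by exists x.1; rewrite /frame_fun /= scale1r -x2; case: (x).
Qed.

Lemma is_frame_line_infty : is_frame (line_infty K) (0, 1%:M).
Proof.
split=> [u v [] | x]; first by rewrite !mul1mx.
rewrite mem_line_infty; split=> [/eqP x1 | [v ->]] /=; last by rewrite scale0r.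
by exists x.2; rewrite /frame_fun /= scale0r mul1mx -x1; case: (x).
Qed.

Lemma frame_ofP L : L \in four_lines -> is_frame L (frame_of L).
Proof.
rewrite !inE /frame_of.
have [-> _ | _] := eqVneq L (line_infty K); first exact: is_frame_line_infty.
have [-> _ | _] := eqVneq L (line_of 0); first exact: is_frame_line_of.
have [-> _ | _] := eqVneq L (line_of 1%:M); first exact: is_frame_line_of.
by move=> /eqP->; apply: is_frame_line_of.
Qed.

Lemma frame_of_cases L :
  [\/ frame_of L = (1, 0), frame_of L = (0, 1%:M), frame_of L = (1, 1%:M)
    | frame_of L = (1, A)].
Proof.
rewrite /frame_of; case: ifP => _; first by constructor 2.
case: ifP => _; first by constructor 1.
by case: ifP => _; [constructor 3 | constructor 4].
Qed.

(** The scalar absorbs the sign that appears when the two frames are exchanged; the value 0 arises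
    from equal frames. *)
Lemma frame_det_cases L L' :
  exists2 c : K, c != 0 &
  exists2 B : 'M[K]_2, [\/ B = 0, B = 1%:M, B = A | B = A - 1%:M] &
    frame_det (frame_of L) (frame_of L') = c *: B.
Proof.
pose P (B : 'M[K]_2) := [\/ B = 0, B = 1%:M, B = A | B = A - 1%:M].
have sgn (D : 'M[K]_2) : P D \/ P (- D) ->
    exists2 c : K, c != 0 & exists2 B : 'M[K]_2, P B & D = c *: B.
  case=> DP; first by exists 1; [apply: oner_neq0 | exists D; rewrite ?scale1r].
  exists (-1); first by rewrite oppr_eq0 oner_neq0.
  by exists (- D); rewrite // scaleN1r opprK.
apply: sgn; rewrite /frame_det /P.
case: (frame_of_cases L) => ->; case: (frame_of_cases L') => -> /=;
  rewrite ?scale1r ?scale0r ?subr0 ?sub0r ?subrr ?opprK ?opprB ?oppr0;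
  by [left; constructor | right; constructor
     | left; constructor 2 | right; constructor 2 | left; constructor 3
     | right; constructor 3 | left; constructor 4 | right; constructor 4].
Qed.

(** Bounds the groupoid from above, by induction on arrows. It serves with [S] the nonzero scalar
    matrices when [A] is scalar, and the nonzero multiples of powers of [A] when trace and
    determinant are 1. *)
Lemma arrow_acts_by (S : 'M[K]_2 -> Prop) :
  S 1%:M -> (forall B B', S B -> S B' -> S (B *m B')) ->
  (forall L L', frame_det (frame_of L) (frame_of L') \in unitmx ->
     S (frame_det (frame_of L) (frame_of L')) /\
     S (invmx (frame_det (frame_of L) (frame_of L')))) ->
  forall L L' (f : point_on L -> point_on L'), arrow four_lines f ->
  exists B, [/\ B \in unitmx, S B & acts_by (frame_of L) (frame_of L') f B].
Proof.
move=> S1 SM SD L L' f.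
elim=> {L L' f} [Li Lj Lk ik jk Li_in Lj_in Lk_in _ | L _
  | L L' L'' f g _ [B [uB SB fB]] _ [B' [uB' SB' gB']] | L L' f g fg _ [B [uB SB fB]]].
- have fri := frame_ofP Li_in; have frj := frame_ofP Lj_in.
  have frk := frame_ofP Lk_in.
  have uik := skew_frame_det_unit fri frk ik.
  have ujk := skew_frame_det_unit frj frk jk.
  exists (invmx (frame_det (frame_of Lj) (frame_of Lk)) *m
    frame_det (frame_of Li) (frame_of Lk)); split.
  + by rewrite unitmx_mul unitmx_inv ujk.
  + by apply: SM; [case: (SD _ _ ujk) | case: (SD _ _ uik)].
  + exact: acts_by_proj_map.
- by exists 1%:M; split; rewrite ?unitmx1 //; apply: acts_by_id.
- exists (B' *m B); split; [by rewrite unitmx_mul uB' | exact: SM |].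
  exact: acts_by_comp fB gB'.
- by exists B; split=> //; apply: acts_by_ext fB.
Qed.

(* The arrow is the loop f_jil o f_ijk. *)
Lemma arrow_cross_ratio Li Lj Lk Ll : pairwise_skew four_lines ->
  Li \in four_lines -> Lj \in four_lines -> Lk \in four_lines -> Ll \in four_lines ->
  Li != Lj -> Li != Lk -> Lj != Lk -> Li != Ll -> Lj != Ll ->
  let D L L' := frame_det (frame_of L) (frame_of L') in
  exists2 f : point_on Li -> point_on Li, arrow four_lines f &
  acts_by (frame_of Li) (frame_of Li) f
    ((invmx (D Li Ll) *m D Lj Ll) *m (invmx (D Lj Lk) *m D Li Lk)).
Proof.
move=> skewL Li_in Lj_in Lk_in Ll_in ij ik jk il jl D.
have sk L L' : L \in four_lines -> L' \in four_lines -> L != L' -> Defs.skew L L'.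
  exact: skewL.
have u L L' : L \in four_lines -> L' \in four_lines -> L != L' -> D L L' \in unitmx.
  move=> L_in L'_in LL'.
  by apply: skew_frame_det_unit (sk _ _ L_in L'_in LL'); apply: frame_ofP.
exists (proj_map (sk _ _ Lj_in Ll_in jl) (sk _ _ Li_in Ll_in il)
   \o proj_map (sk _ _ Li_in Lk_in ik) (sk _ _ Lj_in Lk_in jk)).
  apply: arrow_comp; apply: arrow_proj; rewrite //= !inE negb_or ?ij ?ik ?jk //.
  by rewrite eq_sym ij jl il.
apply: acts_by_comp; first by rewrite unitmx_mul unitmx_inv !u.
  by apply: acts_by_proj_map; apply: frame_ofP.
by apply: acts_by_proj_map; apply: frame_ofP.
Qed.

Lemma line_of_inj : injective (@line_of K).
Proof.
move=> M M' eqM; apply/matrixP => i j.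
have : frame_fun (1, M) (delta_mx j 0) \in line_space (line_of M').
  by rewrite -eqM; apply/frame_line_mem/is_frame_line_of.
by rewrite mem_line_of /= scale1r -!colE => /eqP/matrixP/(_ i 0); rewrite !mxE.
Qed.

Lemma line_of_neq_infty (M : 'M[K]_2) : line_of M != line_infty K.
Proof.
apply/eqP => eqM.
have : frame_fun (1, M) (delta_mx 0 0) \in line_space (line_infty K).
  by rewrite -eqM; apply/frame_line_mem/is_frame_line_of.
rewrite mem_line_infty /= scale1r => /eqP/matrixP/(_ 0 0)/eqP.
by rewrite !mxE eqxx oner_eq0.
Qed.

(** * Loops at each line when the matrix is not scalar *)

Hypothesis nonscalarA : forall c, A <> c%:M.

Lemma uniq_four_lines : uniq four_lines.
Proof.
rewrite /= !inE !negb_or !(inj_eq line_of_inj) !line_of_neq_infty.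
rewrite ![line_infty K == _]eq_sym !line_of_neq_infty /= andbT.
apply/andP; split; last by apply/eqP => /esym; apply: nonscalarA.
rewrite eq_sym -scalemx1 scale1r oner_neq0 /=.
by apply/eqP => /esym; rewrite -(raddf0 (@scalar_mx K 2)); apply: nonscalarA.
Qed.

Lemma frame_of_lines :
  [/\ frame_of (line_of 0) = (1, 0), frame_of (line_infty K) = (0, 1%:M),
      frame_of (line_of 1%:M) = (1, 1%:M) & frame_of (line_of A) = (1, A)].
Proof.
have := uniq_four_lines; rewrite /= !inE !negb_or => /and4P[/and3P[_ n01 n0A] _ n1A _].
rewrite /frame_of !(negPf (line_of_neq_infty _)) !eqxx.
rewrite ![line_of 1%:M == line_of 0]eq_sym ![line_of A == _]eq_sym.
by rewrite (negPf n01) (negPf n0A) (negPf n1A).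
Qed.

(** Bounds every vertex group from below: both generators are realised by the loops of
    [arrow_cross_ratio]. *)
Lemma arrows_acting_by L : pairwise_skew four_lines -> L \in four_lines ->
  (exists2 f : point_on L -> point_on L, arrow four_lines f &
     acts_by (frame_of L) (frame_of L) f A) /\
  (exists2 f : point_on L -> point_on L, arrow four_lines f &
     acts_by (frame_of L) (frame_of L) f (A - 1%:M)).
Proof.
move=> skewL L_in.
pose P L' B := exists2 f : point_on L' -> point_on L', arrow four_lines f &
  acts_by (frame_of L') (frame_of L') f B.
rewrite -/(P L A) -/(P L (A - 1%:M)).
have cross i j k l : all (gtn 4) [:: i; j; k; l] ->
    uniq [:: i; j; k] -> uniq [:: i; j; l] ->
    let line n := nth L four_lines n in
    let D m n := frame_det (frame_of (line m)) (frame_of (line n)) in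
    P (line i) ((invmx (D i l) *m D j l) *m (invmx (D j k) *m D i k)).
  move=> /and5P[i4 j4 k4 l4 _] uijk uijl line D.
  have line_in n : (n < 4)%N -> line n \in four_lines.
    by exact: (@mem_nth _ L four_lines n).
  have ne m n : (m < 4)%N -> (n < 4)%N -> m != n -> line m != line n.
    by move=> m4 n4; rewrite nth_uniq // uniq_four_lines.
  move: uijk uijl; rewrite /= !inE !negb_or !andbT.
  move=> /andP[/andP[ij ik] jk] /andP[/andP[_ il] jl].
  by apply: arrow_cross_ratio; rewrite ?line_in ?ne.
have PN L' B : P L' B -> P L' (- B).
  case=> f fa fB; exists f => //; rewrite -scaleN1r; apply: acts_by_scale fB.
  by rewrite oppr_eq0 oner_neq0.
have invN1 : invmx (- 1%:M) = - 1%:M :> 'M[K]_2.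
  by rewrite -raddfN invmx_scalar invrN1.
have [fr0 frI fr1 frA] := frame_of_lines.
have simpD := (scale1r, scale0r, subr0, sub0r, @opprK 'M[K]_2, opprB, invmx1, invN1,
  mul1mx, mulmx1, mulNmx, mulmxN).
(* Indices 0, 1, 2, 3 stand for the lines of 0, infinity, 1 and [A]. Each quadruple is chosen so
   that the two inverted determinants and one of the other two are 1 or -1, while the last is [A] or
   [A - 1] up to sign. *)
move: L_in; rewrite !inE => /or4P[] /eqP->; split.
- by have := cross 0 1 3 2 isT isT isT; rewrite /= fr0 frI fr1 frA /frame_det /= !simpD.
- have := cross 0 3 1 2 isT isT isT; rewrite /= fr0 frI fr1 frA /frame_det /= !simpD.
  by move/PN; rewrite opprB.
- by have := cross 1 0 2 3 isT isT isT; rewrite /= fr0 frI fr1 frA /frame_det /= !simpD.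
- have := cross 1 2 0 3 isT isT isT; rewrite /= fr0 frI fr1 frA /frame_det /= !simpD.
  by move/PN; rewrite opprB.
- by have := cross 2 3 1 0 isT isT isT; rewrite /= fr0 frI fr1 frA /frame_det /= !simpD.
- have := cross 2 1 3 0 isT isT isT; rewrite /= fr0 frI fr1 frA /frame_det /= !simpD.
  by move/PN; rewrite opprB.
- by have := cross 3 2 0 1 isT isT isT; rewrite /= fr0 frI fr1 frA /frame_det /= !simpD.
- have := cross 3 0 2 1 isT isT isT; rewrite /= fr0 frI fr1 frA /frame_det /= !simpD.
  by move/PN; rewrite opprB.
Qed.

End FourLines.

(** * The Cayley-Hamilton relation and the scalar case *)

Section VertexGroup.

Set Implicit Arguments.
Unset Strict Implicit.

Variables (K : fieldType) (A : 'M[K]_2).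

(** Cayley-Hamilton in dimension two, checked entry by entry. *)
Lemma mulmx_self2 : A *m A = \tr A *: A - (\det A)%:M.
Proof.
rewrite (expand_det_row _ 0) /mxtrace !big_ord_recl !big_ord0 /cofactor !det_mx11.
apply/matrixP => i j; rewrite !mxE !big_ord_recl big_ord0 /=.
have -> : lift 0 0 = 1 :> 'I_2 by apply: val_inj.
have -> : lift 1 0 = 0 :> 'I_2 by apply: val_inj.
have ord2 (k : 'I_2) : k = 0 \/ k = 1.
  by case: k => [[|[|k]] ?] //; [left|right]; apply: val_inj.
by case: (ord2 i) => ->; case: (ord2 j) => ->; rewrite /= ?mulr1n ?mulr0n; ring.
Qed.

(** All frame determinants are then scalar, and scalar matrices fix every point. *)
Lemma scalar_arrow_id (L : line K) (f : point_on L -> point_on L) a :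
  A = a%:M -> L \in four_lines A -> arrow (four_lines A) f -> f =1 id.
Proof.
move=> Aa L_in farr.
pose S (B : 'M[K]_2) := exists2 b, b != 0 & B = b%:M.
have S1 : S 1%:M by exists 1; rewrite ?oner_neq0.
have SM B B' : S B -> S B' -> S (B *m B').
  move=> [b nz_b ->] [b' nz_b' ->]; exists (b * b'); first by rewrite mulf_neq0.
  by rewrite scalar_mxM.
have SD L1 L2 : frame_det (frame_of A L1) (frame_of A L2) \in unitmx ->
    S (frame_det (frame_of A L1) (frame_of A L2)) /\
    S (invmx (frame_det (frame_of A L1) (frame_of A L2))).
  have [c nz_c [B BP ->]] := frame_det_cases A L1 L2.
  have [b ->] : exists b, B = b%:M.
    case: BP => ->; [exists 0 | exists 1 | exists a | exists (a - 1)] => //.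
    - by rewrite raddf0.
    - by rewrite Aa raddfB.
  rewrite scale_scalar_mx unitmxE det_scalar unitrX_pos // unitfE => nz_cb.
  split; first by exists (c * b).
  by exists (c * b)^-1; rewrite ?invr_eq0 // invmx_scalar.
have [B [_ [b nz_b ->] fB]] := arrow_acts_by S1 SM SD farr.
have frL := frame_ofP L_in.
apply: acts_by_eq frL fB _; rewrite -scalemx1; apply: acts_by_scale => //.
exact: acts_by_id.
Qed.

(** * Non-scalar matrices: order three against trace and determinant *)

Section NonScalar.

Hypothesis nonscalarA : forall c, A <> c%:M.

(** Linear independence of [A] and the identity, which allows coefficients to be compared after
    Cayley-Hamilton. *)
Lemma scaled_eq_scalar a b : a *: A = b%:M -> a = 0 /\ b = 0.
Proof.
move=> aA; have [a0 | nz_a] := eqVneq a 0.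
  split=> //; move/matrixP/(_ 0 0): aA.
  by rewrite a0 scale0r !mxE mulr1n => <-.
by case: (@nonscalarA (a^-1 * b)); rewrite -scale_scalar_mx -aA scalerK.
Qed.

(** With [t] the trace and [d] the determinant, the cube of [A] is [(t^2 - d) A - t d], so the
    coefficient of [A] must vanish. *)
Lemma cube_scalar_trace b :
  A *m (A *m A) = b%:M -> \tr A ^+ 2 = \det A.
Proof.
rewrite mulmx_self2 mulmxBr -scalemxAr mul_mx_scalar mulmx_self2 scalerBr scalerA.
rewrite scale_scalar_mx addrAC -scalerBl -expr2 => /eqP.
rewrite subr_eq -raddfD => /eqP/scaled_eq_scalar[/eqP].
by rewrite subr_eq0 => /eqP.
Qed.

Lemma sub1_square_trace c : A - 1%:M = c *: (A *m A) -> c * \tr A = 1 /\ c * \det A = 1.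
Proof.
rewrite mulmx_self2 scalerBr scalerA scale_scalar_mx => AE.
have /scaled_eq_scalar[/eqP tr1 /eqP det1] : (1 - c * \tr A) *: A = (1 - c * \det A)%:M.
  rewrite scalerBl scale1r raddfB /= -[X in X - _](subrK 1%:M) AE.
  by rewrite addrAC [_ - (_)%:M]addrC addrK addrC.
by move: tr1 det1; rewrite !subr_eq0 => /eqP<- /eqP<-.
Qed.

Lemma trace_det_of_cyclic3 (L : line K) :
  pairwise_skew (four_lines A) -> L \in four_lines A -> A \in unitmx ->
  vertex_group_isog (four_lines A) L 'Z_3 -> \tr A = 1 /\ \det A = 1.
Proof.
move=> skewL L_in uA [phi [phiM phi_inj phiP]].
have frL := frame_ofP L_in.
(* The identity arrow is [phi e] for some [e], and [phi 1] composed with [phi e] is [phi e]. *)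
have phi1 : phi 1%g =1 id.
  have /phiP[e phie] := arrow_id L_in.
  by move=> p; rewrite [p in LHS]phie -[LHS]phiM mul1g -phie.
have [[f /phiP[x fx] fA] [g /phiP[y gy] gA]] := arrows_acting_by nonscalarA skewL L_in.
have id1 := @acts_by_id K L (frame_of A L).
have nz_x : x <> 1%g.
  move=> x1; have fid : f =1 id by move=> p; rewrite fx x1 phi1.
  have [c _] := acts_by_uniq frL frL id1 (acts_by_ext fid fA).
  by rewrite scalemx1; apply: nonscalarA.
have trdet : \tr A ^+ 2 = \det A.
  have fff : f \o (f \o f) =1 id.
    move=> p; rewrite /= !fx -[phi x (phi x p)]phiM -[LHS]phiM.
    have -> : (x * (x * x))%g = 1%g.
      by case: {+}x => [[|[|[|//]]] ?]; apply: val_inj.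
    exact: phi1.
  have uAA : A *m A \in unitmx by rewrite unitmx_mul uA.
  have fffA := acts_by_comp uAA (acts_by_comp uA fA fA) fA.
  have [c _] := acts_by_uniq frL frL id1 (acts_by_ext fff fffA).
  rewrite scalemx1; apply: cube_scalar_trace.
(* As [x] generates the group, [A - 1%:M] is proportional to the identity, to [A] or to [A *m A];
   the first two contradict the independence of [A] and the identity. *)
have [y1 | yx | yxx] : [\/ y = 1%g, y = x | y = (x * x)%g].
- case: x nz_x {fx} => [[|[|[|//]]] ?] nz_x; case: y {gy} => [[|[|[|//]]] ?];
    by [case: nz_x; apply: val_inj | constructor 1; apply: val_inj
       | constructor 2; apply: val_inj | constructor 3; apply: val_inj].
- have gid : g =1 id by move=> p; rewrite gy y1 phi1.
  have [c _ /eqP] := acts_by_uniq frL frL id1 (acts_by_ext gid gA).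
  by rewrite scalemx1 subr_eq -raddfD => /eqP/nonscalarA.
- have gf : g =1 f by move=> p; rewrite gy yx fx.
  have [c _ Ac] := acts_by_uniq frL frL fA (acts_by_ext gf gA).
  have /scaled_eq_scalar[_ /eqP] : (1 - c) *: A = 1%:M.
    by rewrite scalerBl -Ac scale1r opprB addrC subrK.
  by rewrite oner_eq0.
have gff : g =1 f \o f by move=> p; rewrite /= gy yxx phiM /= !fx.
have [c nz_c Ac] := acts_by_uniq frL frL (acts_by_comp uA fA fA) (acts_by_ext gff gA).
have [ctr cdet] := sub1_square_trace Ac.
have eq_td : \tr A = \det A by apply: (mulfI nz_c); rewrite ctr cdet.
have nz_d : \det A != 0 by rewrite -unitfE -unitmxE.
have det1 : \det A = 1.
  by apply: (mulfI nz_d); rewrite mulr1 -expr2 -{1}eq_td.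
by rewrite eq_td det1.
Qed.

Lemma cyclic3_of_trace_det (L : line K) :
  pairwise_skew (four_lines A) -> L \in four_lines A ->
  \tr A = 1 -> \det A = 1 ->
  vertex_group_isog (four_lines A) L 'Z_3.
Proof.
move=> skewL L_in tr1 det1.
have frL := frame_ofP L_in.
have A2 : A ^+ 2 = A - 1 by rewrite expr2 -mulmxE mulmx_self2 tr1 det1 scale1r.
have A3 : A ^+ 3 = -1.
  by rewrite exprS A2 mulrBr mulr1 -expr2 A2 addrAC subrr sub0r.
have uA : A \in unitmx by rewrite unitmxE det1 unitr1.
have uAk k : A ^+ k \in unitmx by apply: (@unitrX _ A).
have [[f arr_f fA] _] := arrows_acting_by nonscalarA skewL L_in.
have id1 := @acts_by_id K L (frame_of A L).
have iter_acts k : acts_by (frame_of A L) (frame_of A L) (iter k f) (A ^+ k).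
  elim: k => [|k IHk]; first exact: id1.
  by rewrite exprS; apply: acts_by_comp IHk fA.
have arr_iter k : arrow (four_lines A) (iter k f).
  elim: k => [|k IHk]; first exact: arrow_id.
  exact: arrow_comp IHk arr_f.
have iter3 : iter 3 f =1 id.
  apply: acts_by_eq frL (iter_acts 3) _; rewrite A3 -scaleN1r.
  by apply: acts_by_scale; rewrite ?oppr_eq0 ?oner_neq0.
have iter_mod k : iter (k %% 3) f =1 iter k f.
  move=> p; rewrite {2}(divn_eq k 3) iterD.
  elim: (k %/ 3)%N => // q IHq.
  by rewrite mulSn iterD iter3.
(* The loop acting by [A] serves as generator. The product in ['Z_3] is addition of exponents modulo
   3, which [iter_mod] makes compatible with iteration. *)
exists (fun x : 'Z_3 => iter x f); split=> [x y p | x y eqxy | g].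
- by rewrite /= -iterD; apply: iter_mod.
(* If [i < j], cancelling [A ^+ i] would make [A] or [A ^+ 2 = A - 1] scalar. *)
- have indep i j c : c != 0 -> (i <= j < 3)%N -> A ^+ i = c *: A ^+ j -> i = j.
    move=> nz_c /andP[le_ij j3] Aij; apply/eqP; rewrite eqn_leq le_ij leqNgt.
    apply/negP => lt_ij; have Aji : A ^+ (j - i) = (c^-1)%:M.
      apply: (mulrI (uAk i)); rewrite -exprD subnKC // -mulmxE mul_mx_scalar.
      by rewrite Aij scalerK.
    have : (0 < j - i < 3)%N by rewrite subn_gt0 lt_ij (leq_ltn_trans (leq_subr i j)).
    case: (j - i)%N Aji => [|[|[|k]]] // => [/nonscalarA // | ].
    rewrite A2 => /eqP; rewrite subr_eq -[1]/(1%:M) -raddfD => /eqP AE _.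
    exact: nonscalarA AE.
  have [c nz_c AxAy] : exists2 c, c != 0 & A ^+ x = c *: A ^+ y.
    by apply: (acts_by_uniq frL frL (iter_acts y)); apply: acts_by_ext (iter_acts x).
  apply: val_inj; have [le_xy | le_yx] := leqP x y.
    by apply: indep nz_c _ AxAy; rewrite le_xy ltn_ord.
  apply/esym; apply: (@indep _ _ c^-1); rewrite ?invr_eq0 ?AxAy ?scalerK //.
  by rewrite ltnW ?ltn_ord.
split=> [arr_g | [x gx]]; last by apply: arrow_ext (arr_iter x) => p; rewrite gx.
pose S (B : 'M[K]_2) := exists2 c, c != 0 & exists k, B = c *: A ^+ k.
have S1 : S 1%:M by exists 1; rewrite ?oner_neq0 //; exists 0%N; rewrite scale1r.
have SM B B' : S B -> S B' -> S (B *m B').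
  move=> [b nz_b [k ->]] [b' nz_b' [k' ->]].
  exists (b * b'); first by rewrite mulf_neq0.
  by exists (k + k')%N; rewrite -scalemxAl -scalemxAr scalerA exprD.
have SV B : S B -> S (invmx B).
  (* Since [A ^+ 3 = -1], the inverse of [A ^+ k] is [(-1) ^+ k *: A ^+ (k * 2)]. *)
  case=> b nz_b [k BE]; exists (b^-1 * (-1) ^+ k).
    by rewrite mulf_neq0 ?invr_eq0 ?expf_neq0 // oppr_eq0 oner_neq0.
  exists (k * 2)%N; set C := _ *: _.
  have uB : B \in unitmx by rewrite BE unitmxZ ?unitfE.
  suff BC : B *m C = 1%:M by rewrite -[LHS]mulmx1 -BC mulKmx.
  rewrite BE /C -scalemxAl -scalemxAr scalerA mulVKf // mulmxE -exprD.
  have -> : (k + k * 2 = 3 * k)%N by rewrite mulnC [in RHS]mulSn mulnC.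
  by rewrite exprM A3 -signr_odd -[in X in _ *: X]signr_odd; case: odd;
    rewrite ?scale1r // expr1 scaleN1r opprK.
have SD L1 L2 : frame_det (frame_of A L1) (frame_of A L2) \in unitmx ->
    S (frame_det (frame_of A L1) (frame_of A L2)) /\
    S (invmx (frame_det (frame_of A L1) (frame_of A L2))).
  have [c nz_c [B BP DE]] := frame_det_cases A L1 L2 => uD.
  suff SDet : S (frame_det (frame_of A L1) (frame_of A L2)) by split=> //; apply: SV.
  exists c => //; case: BP DE => -> DE.
  - by move: uD; rewrite DE scaler0 unitmxE det0 unitr0.
  - by exists 0%N.
  - by exists 1%N.
  - by exists 2; rewrite A2.
have [B [_ [c nz_c [k ->]] gB]] := arrow_acts_by S1 SM SD arr_g.
exists (inZp k : 'Z_3) => p; rewrite /= iter_mod.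
by apply: (acts_by_eq frL gB); apply: acts_by_scale.
Qed.

End NonScalar.

End VertexGroup.

(* In characteristic 3 the matrix M2 = -I has trace and determinant 1 and the
   four lines are distinct and pairwise skew, but their group is trivial (they
   are rulings of one quadric); that single instance has to be excluded. *)
Theorem proposition3p19 (K : closedFieldType) (M2 : 'M[K]_2)
    (Ls := [:: line_of 0; line_infty K; line_of 1%:M; line_of M2]) :
  M2 \in unitmx ->
  pairwise_skew Ls ->
  ~ (3%N \in [pchar K] /\ M2 = - 1%:M) ->
  forall L : line K, L \in Ls ->
    (vertex_group_isog Ls L 'Z_3 <-> \tr M2 = 1 /\ \det M2 = 1).
Proof.
move=> unitM2 skewLs not_exception L L_in; split=> [isoL | [tr1 det1]].
  suff nonscalar a : M2 <> a%:M by apply: trace_det_of_cyclic3 nonscalar _ _ _ _ isoL.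
  (* A scalar [M2] makes every loop the identity, against the injectivity of [phi] on a group with
     more than one element. *)
  move=> M2a; have [phi [_ phi_inj phiP]] := isoL.
  have phi_id x : phi x =1 id.
    by apply: scalar_arrow_id M2a L_in _; apply/phiP; exists x.
  by have /phi_inj : phi 0 =1 phi 1 by move=> p; rewrite !phi_id.
apply: cyclic3_of_trace_det => // a M2a; apply: not_exception.
move: tr1 det1; rewrite M2a mxtrace_scalar det_scalar mulr2n => tr1 det1.
(* Multiplying [a + a = 1] by [a] and using [a ^+ 2 = 1] gives [a = 2]; the trace equation then
   reads 4 = 1, which forces characteristic 3. *)
have a2 : a = 2 by move: (congr1 ( *%R a) tr1); rewrite mulrDr -expr2 det1 mulr1.
have char3 : 3 = 0 :> K.
  by rewrite -(subrr (1 : K)) -[X in _ = X - _]tr1 a2; ring.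
split; first by apply/andP; rewrite char3 eqxx.
have -> : a = -1.
  by rewrite a2 -[LHS]subr0 -char3; ring.
by rewrite raddfN.
Qed.
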